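(* Let $X$ be a compact metric space with metric $d$ and let $f\colon X\to X$ be a continuous map. Let $x\in X$. If for every $\epsilon>0$ there is $x_\epsilon\in\mathbb{A}(f)$ such that \[ \limsup_{i\to\infty}d(f^i(x),f^i(x_\epsilon))\le\epsilon, \] then $x\in\mathbb{A}(f)$.
   Context: Let $X$ be a compact metric space with metric $d$ and $f\colon X\to X$ a continuous map. A subset $S\subset X$ is $f$-invariant if $f(S)\subset S$. For $x\in X$, the $\omega$-limit set $\omega(x,f)$ is the set of $y\in X$ such that $\lim_{j\to\infty}f^{i_j}(x)=y$ for some sequence of integers $0\le i_1<i_2<\cdots$. Odometers: given a nondecreasing sequence $m=(m_j)_{j\ge1}$ of positive integers with $m_j\mid m_{j+1}$ for all $j\ge1$ and $\lim_{j\to\infty}m_j=\infty$, let $X(j)=\{0,1,\dots,m_j-1\}$ with the discrete topology, let \[ X_m=\Big\{(x_j)_{j\ge1}\in\prod_{j\ge1}X(j)\colon x_j\equiv x_{j+1}\pmod{m_j}\text{ for all }j\ge1\Big\} \] with the subspace topology from the product space, and define $g_m\colon X_m\to X_m$ by $g_m(x)_j=x_j+1\pmod{m_j}$ for all $x=(x_j)_{j\ge1}\in X_m$ and $j\ge1$. The homeomorphism $g_m$ is called an odometer with periodic structure $m$. A closed $f$-invariant subset $S$ of $X$ is called an odometer if $f|_S\colon S\to S$ is topologically conjugate to such a map, i.e. there are some such $g_m\colon X_m\to X_m$ and a homeomorphism $h\colon X_m\to S$ with $f|_S\circ h=h\circ g_m$. A closed $f$-invariant subset $S$ of $X$ is a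 periodic orbit if there are $x\in S$ and $i>0$ such that $f^i(x)=x$ and $S=\{x,f(x),\dots,f^{i-1}(x)\}$. $\mathbb{A}(f)$ denotes the set of $x\in X$ such that $\omega(x,f)$ is a periodic orbit or an odometer. *)

(* Defs.v *)
From mathcomp Require Import all_boot all_order all_algebra.
From mathcomp Require Import all_classical all_reals all_analysis.

Set Implicit Arguments.
Unset Strict Implicit.
Unset Printing Implicit Defensive.

Import Order.TTheory GRing.Theory Num.Theory.

Local Open Scope classical_set_scope.

Definition invariant_set (T : Type) (f : T -> T) (S : set T) : Prop :=
  f @` S `<=` S.

Definition restr (T : Type) (f : T -> T) (S : set T) (fS : invariant_set f S)
    (z : S) : S :=
  exist _ (f (set_val z)) (mem_set (fS _ (imageP f (set_valP z)))).

Definition homeomorphism (T U : topologicalType) (h : T -> U) : Prop :=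
  exists k : U -> T,
    [/\ cancel h k, cancel k h, continuous h & continuous k].

Definition top_conjugate (T U : topologicalType) (g : T -> T) (f : U -> U) :
    Prop :=
  exists h : T -> U, homeomorphism h /\ f \o h = h \o g.

Definition omega_limit (T : topologicalType) (f : T -> T) (x : T) : set T :=
  [set y | exists i : nat -> nat,
     {homo i : a b / (a < b)%N} /\ iter (i j) f x @[j --> \oo] --> y].

(* Sequences indexed by j >= 1 in the literature are indexed here from 0. *)
Definition periodic_structure (m : nat -> nat) : Prop :=
  [/\ {homo m : i j / (i <= j)%N}, forall j, (0 < m j)%N,
      forall j, (m j %| m j.+1)%N & m j @[j --> \oo] --> \oo].

Definition digits (m : nat -> nat) : topologicalType :=
  prod_topology (fun j => discrete_topology 'I_(m j)).

Definition odometer_space (m : nat -> nat) : set (digits m) :=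
  [set x | forall j, ((x j : 'I_(m j)) = (x j.+1 : 'I_(m j.+1)) %[mod m j])%N].
Arguments odometer_space : clear implicits.

(* [ordS] is the successor modulo [m j] on ['I_(m j)]. *)
Definition digits_succ (m : nat -> nat) (x : digits m) : digits m :=
  fun j => ordS (x j : 'I_(m j)).

Lemma ordS_eqmod (m n : nat) (i : 'I_m) (j : 'I_n) : (m %| n)%N ->
  (i = j %[mod m])%N -> (ordS i = ordS j %[mod m])%N.
Proof.
move=> mn ij; rewrite /= modn_mod modn_dvdm// -addn1 -(addn1 j).
by rewrite -modnDml ij modnDml.
Qed.

Lemma digits_succ_invariant (m : nat -> nat) :
  periodic_structure m -> invariant_set (@digits_succ m) (odometer_space m).
Proof.
move=> [_ _ mdvd _] _ [x xm <-] j.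
exact: ordS_eqmod (mdvd j) (xm j).
Qed.

Definition odometer_map (m : nat -> nat) (hm : periodic_structure m) :
    odometer_space m -> odometer_space m :=
  restr (digits_succ_invariant hm).

Definition is_odometer (T : topologicalType) (f : T -> T) (S : set T) : Prop :=
  closed S /\ exists fS : invariant_set f S,
    exists (m : nat -> nat) (hm : periodic_structure m),
      top_conjugate (odometer_map hm) (restr fS).

Definition is_periodic_orbit (T : topologicalType) (f : T -> T) (S : set T) :
    Prop :=
  [/\ closed S, invariant_set f S &
    exists (x : T) (i : nat), [/\ S x, (0 < i)%N, iter i f x = x &
      S = [set iter k f x | k in `I_i]]].

Definition asymptotic_to_periodic_or_odometer (T : topologicalType)
    (f : T -> T) : set T :=
  [set x | is_periodic_orbit f (omega_limit f x) \/
           is_odometer f (omega_limit f x)].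

(* Main.v *)
(* Call [x] eventually almost periodic if for every [e] there are [N] and [M]
   such that the points [f^i x] and [f^j x] are [e]-close whenever [i, j >= M]
   and [i = j mod N]. This property is preserved under the limits of the
   theorem, by the triangle inequality, and it characterizes the points whose
   omega-limit set is a periodic orbit or an odometer.

   If the omega-limit set [S] is a periodic orbit or an odometer, it splits into
   small clopen pieces permuted cyclically by [f]. These have disjoint
   neighbourhoods [U r], and an orbit converging to [S] must eventually move
   from [U r] to [U r.+1], so it visits each of them along an arithmetic
   progression.

   Conversely, let [x] be eventually almost periodic and [y] in its omega-limit
   set [S]. Then the orbit of [y] is dense in [S], and [y] returns [e]-close
   along all multiples of some [N]. If [y] is not periodic, one finds
   [m 0 %| m 1 %| ...] such that multiples of [m j] are [1/(j+1)]-almost periods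
   of [y], while sufficiently good almost periods of [y] are multiples of [m j].
   The times at which the orbit of [y] comes close to a point of [S] then have
   well-defined residues mod each [m j], and these residues give the conjugacy
   of [S] with the odometer of periodic structure [m]. *)
Require Import Defs.
From mathcomp Require Import all_boot all_order all_algebra.
From mathcomp Require Import all_classical all_reals all_analysis.
From mathcomp Require Import lra ring zify.

Set Implicit Arguments.
Unset Strict Implicit.
Unset Printing Implicit Defensive.

Import Order.TTheory GRing.Theory Num.Theory.
Import metricType_numDomainType.

Local Open Scope classical_set_scope.
Local Open Scope ring_scope.

(** * Metric forms of continuity, clustering and omega-limit sets *)

Section MetricDynamics.
Context {R : realType} {X : metricType R}.
Implicit Types (f : X -> X) (x y z : X) (e : R).

Lemma mdist_path3 (a b c d : X) :
  mdist a d <= mdist a b + mdist b c + mdist c d.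
Proof.
apply: le_trans (metric_triangle _ c _) _.
by rewrite lerD2r; exact: metric_triangle.
Qed.

Lemma near_mdistP z (P : X -> Prop) :
  (\forall u \near z, P u) <->
  exists2 e, 0 < e & forall u, mdist z u < e -> P u.
Proof.
by rewrite nbhs_mdistP; split=> -[e e0 eP]; exists e.
Qed.

Lemma near_mdist_lt z e : 0 < e -> \forall u \near z, mdist z u < e.
Proof. by move=> e0; apply/near_mdistP; exists e. Qed.

Lemma continuous_mdist f z e : continuous f -> 0 < e ->
  exists2 d, 0 < d & forall u, mdist z u < d -> mdist (f z) (f u) < e.
Proof. by move=> cf e0; apply/near_mdistP; exact: (cvgr_dist_lt (cf z) e0). Qed.

Lemma iter_continuous f n : continuous f -> continuous (iter n f).
Proof.
move=> cf; elim: n => [|n IHn] z; first exact: cvg_id.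
by apply: (@continuous_comp _ _ _ (iter n f) f); [exact: IHn|exact: cf].
Qed.

Lemma near_iter f z N e : continuous f -> 0 < e ->
  \forall u \near z, forall r, (r < N)%N -> mdist (iter r f z) (iter r f u) < e.
Proof.
move=> cf e0; elim: N => [|N IHN]; first exact: nearW.
apply: filterS2 IHN (cvgr_dist_lt (@iter_continuous f N cf z) e0).
by move=> u IHu uN r; rewrite ltnS leq_eqVlt => /predU1P[->//|/IHu].
Qed.

Lemma compact_seq_cluster (u : nat -> X) : compact [set: X] ->
  exists z, forall e, 0 < e -> forall M, exists2 i, (M <= i)%N & mdist z (u i) < e.
Proof.
move=> /(_ (u @ \oo) _ filterT)[z [_ zu]]; exists z => e e0 M.
have uM : (u @ \oo) (u @` [set i | (M <= i)%N]).
  by exists M => // i /= Mi; exists i.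
by have [_ [[i Mi <-] zi]] := zu _ _ uM (near_mdist_lt z e0); exists i.
Qed.

Lemma omega_limitP f x y : omega_limit f x y <->
  forall e, 0 < e -> forall M,
    exists2 i, (M <= i)%N & mdist y (iter i f x) < e.
Proof.
split=> [[i [imono iy]] e e0 M|H].
  have [n _ nP] := cvgr_dist_lt iy e0.
  have ige j : (j <= i j)%N.
    by elim: j => // j IHj; apply: leq_ltn_trans IHj _; exact: imono.
  exists (i (maxn n M)); last by apply: nP; exact: leq_maxl.
  exact: leq_trans (leq_maxr n M) (ige _).
have /choice[s sP] : forall p : nat * nat, exists i,
    (p.1 <= i)%N /\ mdist y (iter i f x) < p.2.+1%:R^-1.
  move=> [M j] /=; have [|i Mi yi] := H j.+1%:R^-1 _ M.
    by rewrite invr_gt0 ltr0Sn.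
  by exists i.
(* Each time is chosen past the previous one and within [1/(j+1)] of [y]. *)
pose i := fix i j := if j is k.+1 then s ((i k).+1, k.+1) else s (0, 0)%N.
have iP j : mdist y (iter (i j) f x) < j.+1%:R^-1.
  by case: j => [|j]; [have [] := sP (0, 0)%N|have [] := sP ((i j).+1, j.+1)].
exists i; split.
  by apply: homo_ltn => [? ? ?|j]; [exact: ltn_trans|have [] := sP ((i j).+1, j.+1)].
apply/cvgrPdist_lt => e e0.
have := near_infty_natSinv_lt (PosNum e0); apply: filterS => j /=.
exact: lt_trans.
Qed.

Lemma closed_omega_limit f x : closed (omega_limit f x).
Proof.
move=> y yc; apply/omega_limitP => e e0 M.
have e20 : 0 < e / 2 by lra.
have [z [/omega_limitP/(_ _ e20 M)[i Mi zi] yz]] := yc _ (near_mdist_lt y e20).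
by exists i => //; have := metric_triangle y z (iter i f x); lra.
Qed.

Lemma omega_limit_invariant f x :
  continuous f -> invariant_set f (omega_limit f x).
Proof.
move=> cf _ [y /omega_limitP yx <-]; apply/omega_limitP => e e0 M.
have [d d0 dP] := continuous_mdist y cf e0.
by have [i Mi /dP yi] := yx d d0 M; exists i.+1 => //; exact: leqW.
Qed.

Lemma omega_limit_iter f x y n :
  continuous f -> omega_limit f x y -> omega_limit f x (iter n f y).
Proof.
move=> cf yx; elim: n => // n IHn.
by apply: (omega_limit_invariant cf); exists (iter n f y).
Qed.

Lemma omega_limit_neq0 f x : compact [set: X] -> exists y, omega_limit f x y.
Proof.
move=> /(compact_seq_cluster (fun i => iter i f x))[y yP].
by exists y; apply/omega_limitP.
Qed.

(** Otherwise the orbit is outside [V] at arbitrarily late times, and a cluster point of these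
    values lies in the omega-limit set, hence in the interior of [V]. *)
Lemma near_omega_limit f x (V : set X) : compact [set: X] ->
  (forall w, omega_limit f x w -> nbhs w V) ->
  exists M, forall i, (M <= i)%N -> V (iter i f x).
Proof.
move=> cptX oV; apply: contrapT => /forallNP nV.
have /choice[s sP] : forall M, exists i, (M <= i)%N /\ ~ V (iter i f x).
  move=> M; have /existsNP[i /not_implyP[Mi Vi]] := nV M.
  by exists i.
have [z zP] := compact_seq_cluster (fun M => iter (s M) f x) cptX.
have /oV/near_mdistP[d d0 dV] : omega_limit f x z.
  apply/omega_limitP => e e0 M; have [i Mi zi] := zP e e0 M.
  by exists (s i) => //; apply: leq_trans Mi _; have [] := sP i.
by have [i _ /dV] := zP d d0 0%N; have [] := sP i.
Qed.

(** * Eventually almost periodic orbits and regular recurrence *)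

Definition eventually_almost_periodic f x := forall e, 0 < e ->
  exists N M, (0 < N)%N /\ forall i j, (M <= i)%N -> (M <= j)%N ->
    i = j %[mod N] -> mdist (iter i f x) (iter j f x) <= e.

Definition almost_period f y e n :=
  forall i, mdist (iter (n + i) f y) (iter i f y) <= e.

(** Regular recurrence in a form uniform along the orbit: [almost_period] bounds the displacement at
    every time [i]. *)
Definition regularly_recurrent f y := forall e, 0 < e ->
  exists2 N, (0 < N)%N & forall n, almost_period f y e (N * n).

(** At a suitable late time [k] the orbit of [x] starts shadowing that of [y] up to time
    [N * n + i]; only [k], not [N], depends on [n] and [i]. *)
Lemma eap_regularly_recurrent f x y : continuous f ->
  eventually_almost_periodic f x -> omega_limit f x y -> regularly_recurrent f y.
Proof.
move=> cf xap /omega_limitP yx e e0; have e30 : 0 < e / 3 by lra.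
have [N [M [N0 NP]]] := xap _ e30; exists N => // n i.
have /near_mdistP[d d0 dP] := @near_iter f y (N * n + i).+1 _ cf e30.
have [k Mk /dP yk] := yx d d0 M.
have k1 := yk _ (ltnSn _).
have k2 := yk i (leq_ltn_trans (leq_addl _ _) (ltnSn _)).
have := NP ((N * n + i) + k)%N (i + k)%N.
rewrite -addnA mulnC modnMDl addnA => /(_ _ _ erefl).
rewrite (iterD (n * N + i)) (iterD i) => /(_ (leq_trans Mk (leq_addl _ _))).
move=> /(_ (leq_trans Mk (leq_addl _ _))) k3.
rewrite mulnC in k1; have := mdist_path3 (iter (n * N + i) f y)
  (iter (n * N + i) f (iter k f x)) (iter i f (iter k f x)) (iter i f y).
by rewrite (metric_sym (iter i f (iter k f x))); lra.
Qed.

Lemma eap_orbit_dense f x y z : continuous f -> eventually_almost_periodic f x ->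
  omega_limit f x y -> omega_limit f x z ->
  forall e, 0 < e -> exists n, mdist z (iter n f y) < e.
Proof.
move=> cf xap /omega_limitP yx /omega_limitP zx e e0; have e30 : 0 < e / 3 by lra.
have [N [M [N0 NP]]] := xap _ e30.
have /near_mdistP[d d0 dP] := @near_iter f y N _ cf e30.
have [a Ma /dP ya] := yx d d0 M.
have [b ab zb] := zx _ e30 a.
(* Only exponents below [N] are controlled near [y]; reducing [b - a] mod [N] keeps the class of the
   time [b]. *)
exists ((b - a) %% N)%N; have r1 := ya _ (ltn_pmod (b - a) N0).
have := NP ((b - a) %% N + a)%N b.
rewrite modnDml subnK// => /(_ _ _ erefl).
rewrite iterD => /(_ (leq_trans Ma (leq_addl _ _)) (leq_trans Ma ab)) r2.
have := mdist_path3 z (iter b f x) (iter ((b - a) %% N) f (iter a f x))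
  (iter ((b - a) %% N) f y).
rewrite (metric_sym (iter b f x)) (metric_sym (iter _ f (iter a f x)) (iter _ f y)).
lra.
Qed.

(** * Almost periods and residues of return times *)

Lemma almost_period0 f y e : 0 <= e -> almost_period f y e 0.
Proof. by move=> e0 i; rewrite mdistxx. Qed.

Lemma almost_periodD f y e e' n n' : almost_period f y e n ->
  almost_period f y e' n' -> almost_period f y (e + e') (n + n').
Proof.
move=> nP n'P i; have := nP (n' + i)%N; have := n'P i; rewrite addnA.
have := metric_triangle (iter (n + n' + i) f y) (iter (n' + i) f y) (iter i f y).
lra.
Qed.

Lemma almost_period_modn f y e N a b :
  (forall n, almost_period f y e (N * n)) -> a = b %[mod N] ->
  mdist (iter a f y) (iter b f y) <= e.
Proof.
move=> NP; wlog ba : a b / (b <= a)%N => [hw ab|].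
  by have [/hw|/ltnW/hw] := leqP b a; [exact|rewrite metric_sym; exact].
move=> /eqP; rewrite (eqn_mod_dvd _ ba) => /dvdnP[q qE].
by have := NP q b; rewrite mulnC -qE subnK.
Qed.

Definition separating_period f y m := exists2 e, 0 < e &
  forall n, almost_period f y e n -> (m %| n)%N.

(* The classes mod [N] of arbitrarily good almost periods form a subgroup of
   [Z/N]; the refined period [m'] is its least positive representative, and
   finiteness of [Z/N] gives a single [e] excluding all the other classes. *)
Lemma separating_period_refine f y m e : regularly_recurrent f y ->
  (0 < m)%N -> separating_period f y m -> 0 < e ->
  exists m', [/\ (0 < m')%N, (m %| m')%N, separating_period f y m' &
                 forall n, almost_period f y e (m' * n)].
Proof.
move=> yrec m0 [d d0 dP] e0; have e20 : 0 < e / 2 by lra.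
have [N0 N00 N0P] := yrec _ e20.
(* A multiple of [N0], so that times congruent mod [N] are [e / 2]-close on the orbit, and of [m],
   so that classes mod [N] decide divisibility by [m]. *)
pose N := (N0 * m)%N; have Npos : (0 < N)%N by rewrite muln_gt0 N00.
pose H n := forall c, 0 < c ->
  exists2 n', n' = n %[mod N] & almost_period f y c n'.
have HD n n' : H n -> H n' -> H (n + n')%N.
  move=> nH n'H c c0; have c20 : 0 < c / 2 by lra.
  have [k kn kP] := nH _ c20; have [k' kn' kP'] := n'H _ c20.
  exists (k + k')%N; first by rewrite -modnDm kn kn' modnDm.
  by rewrite (splitr c); exact: almost_periodD.
have HN : H N.
  by move=> c c0; exists 0%N; [rewrite modnn mod0n|exact/almost_period0/ltW].
have HM n k : H n -> H (n * k)%N.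
  move=> nH; elim: k => [|k IHk]; last by rewrite mulnS; exact: HD.
  by rewrite muln0 => c c0; exists 0%N => //; exact/almost_period0/ltW.
have Hmod n n' : n = n' %[mod N] -> H n -> H n'.
  by move=> nn' nH c c0; have [k kn kP] := nH c c0; exists k => //; rewrite kn.
have Hex : exists n, `[< (0 < n)%N /\ H n >] by exists N; apply/asboolP.
have [m' /asboolP[m'0 m'H] m'min] := ex_minnP Hex.
have Hdvd n : H n -> (m' %| n)%N.
  move=> nH; have nmH : H (n %% m')%N.
    (* Subtraction of a multiple of [m'] is done mod [N], where [N.-1] acts as [-1]. *)
    apply: (@Hmod (n + m' * ((n %/ m') * N.-1))%N); last exact/HD/HM.
    suff -> : (n + m' * (n %/ m' * N.-1) = n %/ m' * m' * N + n %% m')%N.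
      by rewrite modnMDl.
    by rewrite [X in (X + _)%N](divn_eq n m') -[in RHS](prednK Npos); ring.
  rewrite /dvdn -leqn0 leqNgt; apply/negP => nm0.
  have /m'min : `[< (0 < n %% m')%N /\ H (n %% m')%N >] by exact/asboolP.
  by rewrite leqNgt ltn_pmod.
exists m'; split => //.
- have [n nm' /dP mn] := m'H d d0.
  have mN : (m %| N)%N by rewrite dvdn_mull.
  by rewrite /dvdn -(modn_dvdm _ mN) -nm' modn_dvdm.
- have Hsep B : exists2 c, 0 < c & forall r, (r < B)%N -> ~ H r ->
      forall n, n = r %[mod N] -> ~ almost_period f y c n.
    elim: B => [|B [c c0 cP]]; first by exists 1.
    have [BH|/existsNP[c' /not_implyP[c'0 c'P]]] := pselect (H B).
      by exists c => // r; rewrite ltnS leq_eqVlt => /predU1P[->//|/cP].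
    exists (Num.min c c'); first by rewrite lt_min c0 c'0.
    move=> r; rewrite ltnS leq_eqVlt => /predU1P[->{r}|rB] rH n nr nP.
      apply: c'P; exists n => // i.
      by apply: le_trans (nP i) _; rewrite ge_min lexx orbT.
    apply: (cP r rB rH n nr) => i.
    by apply: le_trans (nP i) _; rewrite ge_min lexx.
  have [c c0 cP] := Hsep N.
  exists c => // n nP; apply/Hdvd/(@Hmod (n %% N)%N); first by rewrite modn_mod.
  apply: contrapT => nH.
  by apply: (cP _ _ nH n _ nP); rewrite ?modn_mod// ltn_pmod.
(* One [e / 2] is spent on the almost period [k] in the class of [m' * n], the other on replacing
   [k] by [m' * n]. *)
- move=> n; have [k kn kP] := HM _ n m'H _ e20.
  move=> i; have r1 := kP i.
  have r2 : mdist (iter (m' * n + i) f y) (iter (k + i) f y) <= e / 2.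
    apply: (almost_period_modn N0P).
    have N0N : (N0 %| N)%N by rewrite dvdn_mulr.
    rewrite -modnDml -[RHS]modnDml -(modn_dvdm (m' * n) N0N).
    by rewrite -(modn_dvdm k N0N) kn.
  have := metric_triangle (iter (m' * n + i) f y) (iter (k + i) f y) (iter i f y).
  lra.
Qed.

(** From two times close to [z] the orbit evolves alike for [N] steps, hence for ever by almost
    periodicity mod [N]. So [a - b] acts as a good almost period, divisible by [m]. *)
Lemma near_orbit_eqmod f y m z : continuous f -> regularly_recurrent f y ->
  (0 < m)%N -> separating_period f y m -> exists2 d, 0 < d & forall a b,
    mdist z (iter a f y) < d -> mdist z (iter b f y) < d -> a = b %[mod m].
Proof.
(* In [close], [e/4] goes to each reduction mod [N] and [e/8] to each comparison with [z]; the last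
   [e/4] pays for writing [a - b] as a sum. *)
move=> cf yrec m0 [e e0 eP]; have [e40 e80] : 0 < e / 4 /\ 0 < e / 8 by lra.
have [N0 N00 N0P] := yrec _ e40.
pose N := (N0 * m)%N; have Npos : (0 < N)%N by rewrite muln_gt0 N00.
have NP n : almost_period f y (e / 4) (N * n) by rewrite /N -mulnA; exact: N0P.
have /near_mdistP[d d0 dP] := @near_iter f z N _ cf e80.
exists d => // a b /dP za /dP zb.
have close i : mdist (iter (i + a) f y) (iter (i + b) f y) <= 3 / 4 * e.
  have r1 c : mdist (iter (i + c) f y) (iter (i %% N + c) f y) <= e / 4.
    by apply: almost_period_modn NP _; rewrite modnDml.
  have := za _ (ltn_pmod i Npos); have := zb _ (ltn_pmod i Npos).
  rewrite -!iterD => zbi zai.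
  have := mdist_path3 (iter (i + a) f y) (iter (i %% N + a) f y)
    (iter (i %% N + b) f y) (iter (i + b) f y).
  have := metric_triangle (iter (i %% N + a) f y) (iter (i %% N) f z)
    (iter (i %% N + b) f y).
  rewrite (metric_sym _ (iter (i %% N) f z)).
  rewrite (metric_sym (iter (i %% N + b) f y) (iter (i + b) f y)).
  have := r1 a; have := r1 b; lra.
(* [a + N.-1 * b] stands for [a - b], to which it is congruent mod [m]. *)
have : almost_period f y e (a + N.-1 * b).
  move=> i; have r1 := close (N.-1 * b + i)%N; have r2 := NP b i.
  have aE : (a + N.-1 * b + i = N.-1 * b + i + a)%N by ring.
  have bE : (N * b + i = N.-1 * b + i + b)%N.
    by rewrite -[in LHS](prednK Npos); ring.
  rewrite bE in r2; have := metric_triangle (iter (N.-1 * b + i + a) f y)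
    (iter (N.-1 * b + i + b) f y) (iter i f y).
  rewrite aE; lra.
move=> /eP mab; apply/eqP; rewrite -(eqn_modDr (N.-1 * b)).
have -> : (b + N.-1 * b = b * N0 * m)%N.
  by rewrite -mulSn prednK// mulnC mulnA.
by rewrite modnMl; exact: mab.
Qed.

End MetricDynamics.

(** * Cyclic partitions and eventual almost periodicity *)

Section CyclicPartition.
Context {R : realType} {X : metricType R}.
Implicit Types (f : X -> X) (x y z w : X) (S : set X) (e : R).

(* The pieces of the partition are the classes of [c] mod [N]. *)
Definition cyclic_partition f S e := exists N (c : X -> nat), (0 < N)%N /\
  [/\ forall w, S w -> c (f w) = (c w).+1 %[mod N],
      forall w, S w -> exists2 d, 0 < d & forall w', S w' ->
        mdist w w' < d -> c w' = c w %[mod N] &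
      forall w w', S w -> S w' -> c w = c w' %[mod N] -> mdist w w' <= e].

Lemma cyclic_partition_eap f x : compact [set: X] -> continuous f ->
  (forall e, 0 < e -> cyclic_partition f (omega_limit f x) e) ->
  eventually_almost_periodic f x.
Proof.
move=> cptX cf part e e0; have e20 : 0 < e / 2 by lra.
have [N [c [N0 [cS c_loc c_diam]]]] := part _ e20; exists N.
(* Half radii keep distinct classes disjoint: two centres sharing [u] are closer than the larger
   radius. The cap on [d] bounds distances within a class by [e/4 + e/2 + e/4]. *)
pose U r u := exists w d, [/\ omega_limit f x w, c w = r %[mod N],
  mdist w u < d / 2, d <= e / 2 &
  forall w', omega_limit f x w' -> mdist w w' < d -> c w' = c w %[mod N]].
have U_open r w : omega_limit f x w -> c w = r %[mod N] -> \forall u \near w, U r u.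
  move=> xw wr; have [d d0 dP] := c_loc w xw.
  apply/near_mdistP; exists (Num.min d (e / 2) / 2).
    by rewrite divr_gt0// lt_min d0.
  move=> u wu; exists w, (Num.min d (e / 2)); split => //.
    by rewrite ge_min lexx orbT.
  by move=> w' xw'; rewrite lt_min => /andP[wd _]; exact: dP.
have U_inj u r s : U r u -> U s u -> r = s %[mod N].
  move=> [w [d [xw wr wu de dP]]] [w' [d' [xw' ws w'u de' dP']]].
  rewrite -wr -ws; have := metric_triangle w u w'; rewrite (metric_sym u w') => t.
  have [dd|dd] := leP d d'.
    by apply: dP' => //; rewrite metric_sym; lra.
  by symmetry; apply: dP => //; lra.
have U_diam u v r s : r = s %[mod N] -> U r u -> U s v -> mdist u v <= e.
  move=> rs [w [d [xw wr wu de dP]]] [w' [d' [xw' ws w'v de' dP']]].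
  have := c_diam w w' xw xw'; rewrite wr ws => /(_ rs).
  have := mdist_path3 u w w' v; rewrite (metric_sym u w); lra.
(* The points that [f] moves from some [U r] to [U r.+1] form a neighbourhood of the omega-limit
   set. *)
have [M MP] : exists M, forall i, (M <= i)%N ->
    exists r, U r (iter i f x) /\ U r.+1 (f (iter i f x)).
  apply: (@near_omega_limit _ _ f x
    [set u | exists r, U r u /\ U r.+1 (f u)] cptX) => w xw.
  have xfw : omega_limit f x (f w) by apply: omega_limit_invariant => //; exists w.
  apply: filterS2 (U_open _ _ xw erefl) (cf w _ (U_open _ _ xfw (cS w xw))).
  by move=> u uU fuU; exists (c w).
have rP k : exists r, U r (iter (M + k) f x) /\ U r.+1 (iter (M + k).+1 f x).
  by have [r rP] := MP (M + k)%N (leq_addr _ _); exists r.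
have {rP}[r rP] := choice rP.
have rE k : r k = (r 0%N + k)%N %[mod N].
  elim: k => [|k IHk]; first by rewrite addn0.
  have := U_inj _ _ _ (rP k.+1).1; rewrite addnS => /(_ _ (rP k).2) ->.
  by rewrite -addn1 -modnDml IHk modnDml addn1 addnS.
exists M; split => // i j /subnKC <- /subnKC <- ij.
apply: U_diam (rP _).1 (rP _).1; rewrite rE [RHS]rE.
by apply/eqP; rewrite eqn_modDl -(eqn_modDl M); exact/eqP.
Qed.

(** The pieces are single points, labelled by time mod the least period, of which the given [k] may
    be a proper multiple. *)
Lemma periodic_orbit_partition f S e : 0 < e ->
  is_periodic_orbit f S -> cyclic_partition f S e.
Proof.
move=> e0 [_ _ [p [k [_ k0 kp SE]]]].
have Hex : exists n, `[< (0 < n)%N /\ iter n f p = p >].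
  by exists k; apply/asboolP.
have [n /asboolP[n0 np] nmin] := ex_minnP Hex.
have iter_mul q : iter (q * n) f p = p.
  by elim: q => // q IHq; rewrite mulSn addnC iterD np.
have iter_mod a : iter a f p = iter (a %% n) f p.
  by rewrite {1}(divn_eq a n) addnC iterD iter_mul.
have iter_inj a b : iter a f p = iter b f p -> a = b %[mod n].
  wlog : a b / (a %% n < b %% n)%N => [hw ab|anbn ab].
    by case: (ltngtP (a %% n) (b %% n)) => // /hw -> //; rewrite ab.
  (* After [a %% n] steps the point is [iter b f p], from which [n - b %% n] steps lead back to [p]:
     a return before time [n]. *)
  have : iter (n - b %% n + a %% n) f p = p.
    rewrite iterD -iter_mod ab iter_mod -iterD subnK//.
    by rewrite ltnW// ltn_pmod.
  have bn := ltn_pmod b n0.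
  move=> abp; have /nmin : `[< (0 < n - b %% n + a %% n)%N /\
      iter (n - b %% n + a %% n) f p = p >] by apply/asboolP; split => //; lia.
  lia.
pose c w := xget 0%N [set a | iter a f p = w].
have cP w : S w -> iter (c w) f p = w.
  by rewrite SE => -[a _ ap]; apply: (@xgetPex _ 0%N [set a | iter a f p = w]); exists a.
have Sf w : S w -> S (f w).
  rewrite SE => -[a /= ak <-].
  have [ak1|ak1] := ltnP a.+1 k; first by exists a.+1.
  have ak' : a.+1 = k by apply/eqP; rewrite eqn_leq ak1 andbT.
  by exists 0%N => //=; rewrite -iterS ak' kp.
exists n, c; split => //; split => [w Sw|w Sw|w w' Sw Sw' ww'].
- by apply: iter_inj; rewrite cP /= ?cP//; exact: Sf.
- have cl : closed (S `\ w).
    apply: (accessible_finite_set_closed.1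
      (hausdorff_accessible (@metric_hausdorff _ X))).
    by apply: finite_setD; rewrite SE; exact: finite_image.
  have /near_mdistP[d d0 dP] : nbhs w (~` (S `\ w)).
    by apply: open_nbhs_nbhs; split; [exact: closed_openC|move=> [_ []]].
  exists d => // w' Sw' /dP ww'; suff -> : w' = w by [].
  by apply: contrapT => w'w; apply: ww'.
- rewrite -(cP w)// -(cP w')// iter_mod ww' -iter_mod mdistxx; exact: ltW.
Qed.

(** * Stability under limits *)

Lemma limn_esup_lt_near (u : nat -> R) (l l' : R) :
  (limn_esup (fun i => (u i)%:E) <= l%:E)%E -> l < l' ->
  exists M, forall i, (M <= i)%N -> u i < l'.
Proof.
move=> ul ll'; have : (limn_esup (fun i => (u i)%:E) < l'%:E)%E.
  by apply: le_lt_trans ul _; rewrite lte_fin.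
move=> /ereal_inf_lt[_ [V [M _ MV] <-]] Vl'; exists M => i Mi.
rewrite -lte_fin; apply: le_lt_trans Vl'; apply: ereal_sup_ubound.
by exists i => //; exact: MV.
Qed.

Lemma eap_limit f x :
  (forall e, 0 < e -> exists y, eventually_almost_periodic f y /\
    (limn_esup (fun i => (mdist (iter i f x) (iter i f y))%:E) <= e%:E)%E) ->
  eventually_almost_periodic f x.
Proof.
move=> H e e0; have e40 : 0 < e / 4 by lra.
(* The gap turns the limsup bound into a strict eventual bound [e / 3], one third of the total
   error. *)
have e43 : e / 4 < e / 3 by lra.
have [y [yap /limn_esup_lt_near/(_ e43)[M MP]]] := H _ e40.
have e30 : 0 < e / 3 by lra.
have [N [M' [N0 NP]]] := yap _ e30; exists N, (maxn M M'); split => // i j.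
rewrite !geq_max => /andP[Mi M'i] /andP[Mj M'j] /(NP _ _ M'i M'j).
have := mdist_path3 (iter i f x) (iter i f y) (iter j f y) (iter j f x).
have := MP _ Mi; have := MP _ Mj.
rewrite (metric_sym (iter j f y)); lra.
Qed.

End CyclicPartition.

(** * Topology of the odometer in terms of digits *)

Section OdometerTopology.
Implicit Types (m : nat -> nat).

(** Serves both for the subspace topology and for the topology that each coordinate induces on the
    product. *)
Lemma cvg_initial (S : choiceType) (T : topologicalType) (f : S -> T)
    (F : set_system S) (s : initial_topology f) : Filter F ->
  f t @[t --> F] --> f s -> F --> s.
Proof.
move=> FF fF A [_ [[C Cop <-] Cs] CA]; rewrite nbhs_filterE.
by apply: filterS CA _; apply: fF; exact: open_nbhs_nbhs.
Qed.

Lemma odometer_digit m (a : odometer_space m) j l : periodic_structure m ->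
  (j <= l)%N -> val a j = val a l %[mod m j].
Proof.
move=> [_ _ mdvd _] /subnKC <-; elim: (l - j)%N => [|k IHk]; first by rewrite addn0.
have mjk : (m j %| m (j + k))%N.
  by elim: k {IHk} => [|k IHk]; rewrite ?addn0// addnS (dvdn_trans IHk).
rewrite IHk addnS -[LHS](modn_dvdm _ mjk) -[RHS](modn_dvdm _ mjk).
by congr (_ %% _)%N; exact: set_valP a (j + k)%N.
Qed.

Lemma odometer_digit_le m (a b : odometer_space m) j l : periodic_structure m ->
  (j <= l)%N -> val a l = val b l -> val a j = val b j.
Proof.
move=> hm jl abl; apply: val_inj => /=.
have := odometer_digit a hm jl; rewrite abl -(odometer_digit b hm jl).
by rewrite !modn_small.
Qed.

Lemma near_odometer_digit m (a : odometer_space m) j :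
  \forall b \near a, val b j = val a j.
Proof.
have c1 : {for a, continuous (set_val : odometer_space m -> digits m)}.
  exact: initial_continuous.
have c2 := @proj_continuous nat (fun j => discrete_topology 'I_(m j)) j (set_val a).
exact: (continuous_comp c1 c2 (discrete_set1 _)).
Qed.

Lemma odometer_cvg m (T : Type) (F : set_system T) (g : T -> odometer_space m)
    (a : odometer_space m) : Filter F ->
  (forall j, \forall t \near F, val (g t) j = val a j) -> g t @[t --> F] --> a.
Proof.
move=> FF H; apply: cvg_initial; apply/cvg_sup => j.
apply: cvg_initial => B /= /principal_filterP Ba.
by apply: filterS (H j) => t gt /=; rewrite set_valE gt.
Qed.

(** A digit determines all earlier ones, so points outside [V] agreeing with [a] at digit [j] would
    converge to [a] as [j] grows. *)
Lemma odometer_cylinder m (a : odometer_space m) (V : set (odometer_space m)) :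
  periodic_structure m -> nbhs a V ->
  exists j, forall b : odometer_space m, val b j = val a j -> V b.
Proof.
move=> hm aV; apply: contrapT => /forallNP nV.
have /choice[b bP] : forall j, exists b : odometer_space m,
    val b j = val a j /\ ~ V b.
  by move=> j; have /existsNP[b /not_implyP[bj Vb]] := nV j; exists b.
have /(_ _ aV)[n _ /(_ n (leqnn n))] : b j @[j --> \oo] --> a.
  apply: odometer_cvg => j; exists j => // l jl.
  by apply: odometer_digit_le hm jl _; have [] := bP l.
by have [] := bP n.
Qed.

End OdometerTopology.

(** * Cyclic partitions of odometers *)

Section OdometerPartition.
Context {R : realType} {X : metricType R}.
Implicit Types (f : X -> X) (x y z w : X) (S : set X) (e : R).

Lemma near_set_val S (z : S) (P : S -> Prop) : (\forall w \near z, P w) <->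
  exists2 d : R, 0 < d & forall w : S, mdist (val z) (val w) < d -> P w.
Proof.
split=> [[_ [[C Cop <-] Cz] CP]|[d d0 dP]].
  have /near_mdistP[d d0 dC] : nbhs (val z) C by exact: open_nbhs_nbhs.
  by exists d => // w /dC Cw; exact: CP.
have zd : \forall w \near z, mdist (val z) (val w) < d.
  exact: (@initial_continuous S X set_val z _ (near_mdist_lt (val z) d0)).
exact: filterS dP zd.
Qed.

Lemma odometer_partition f S e : compact [set: X] -> 0 < e ->
  is_odometer f S -> cyclic_partition f S e.
Proof.
move=> cptX e0 [cS [fS [m [hm [h [[k [hk kh ch ck]] fh]]]]]].
have e20 : 0 < e / 2 by lra.
have near_h a : exists j, forall b : odometer_space m, val b j = val a j ->
    mdist (val (h a)) (val (h b)) < e / 2.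
  have hz : \forall w \near h a, mdist (val (h a)) (val w) < e / 2.
    by apply/near_set_val; exists (e / 2).
  exact: odometer_cylinder hm (ch a _ hz).
have near_k (z : S) j : exists2 d : R, 0 < d & forall w : S,
    mdist (val z) (val w) < d -> val (k w) j = val (k z) j.
  exact: (near_set_val _ _).1 (ck z _ (near_odometer_digit (k z) j)).
(* Uniform continuity of [h], by compactness of [X]: bad pairs for each [J] would have images
   clustering at some [z] in [S], and continuity of [k] and [h] at [z] brings both images within
   [e / 2] of [z]. *)
have [J JP] : exists J, forall a b : odometer_space m, val a J = val b J ->
    mdist (val (h a)) (val (h b)) <= e.
  apply: contrapT => /forallNP nJ.
  have /choice[ab abP] : forall J, exists ab : odometer_space m * odometer_space m,
      val ab.1 J = val ab.2 J /\ e < mdist (val (h ab.1)) (val (h ab.2)).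
    move=> J; have /existsNP[a /existsNP[b /not_implyP[abJ /negP]]] := nJ J.
    by rewrite -ltNge => ?; exists (a, b).
  have [z zP] := compact_seq_cluster (fun J => val (h (ab J).1)) cptX.
  have Sz : S z.
    apply: cS => V /near_mdistP[d d0 dV]; have [i _ zi] := zP d d0 0%N.
    by exists (val (h (ab i).1)); split; [exact: set_valP|exact: dV].
  pose z' : S := exist _ z (mem_set Sz).
  have [j jP] := near_h (k z'); have [d d0 dP] := near_k z' j.
  have [J jJ /dP] := zP d d0 j; rewrite hk => aj.
  have [abJ] := abP J; have := odometer_digit_le hm jJ abJ; rewrite aj.
  move=> /esym/jP; have := jP _ aj.
  have := metric_triangle (val (h (ab J).1)) (val (h (k z'))) (val (h (ab J).2)).
  rewrite (metric_sym _ (val (h (k z')))); lra.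
(* The class is digit [J] of the preimage under [h]; the default 0 only occurs off [S]. *)
pose c w := xget 0%N [set n | exists a, val (h a) = w /\ nat_of_ord (val a J) = n].
have cE a : c (val (h a)) = val a J.
  have : exists n b, val (h b) = val (h a) /\ nat_of_ord (val b J) = n.
    by exists (val a J), a.
  by move=> /(xgetPex 0%N)[b [/val_inj/(can_inj hk) -> caE]]; rewrite [RHS]caE.
have SE w : S w -> exists a, w = val (h a).
  by move=> Sw; exists (k (exist _ w (mem_set Sw))); rewrite kh.
have m0 : (0 < m J)%N by case: (hm).
exists (m J), c; split => //; split.
- move=> _ /SE[a ->].
  have -> : f (val (h a)) = val (h (odometer_map hm a)).
    by have := congr1 (fun g => val (g a)) fh.
  by rewrite !cE /= modn_mod.
- move=> _ /SE[a ->]; have [d d0 dP] := near_k (h a) J.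
  by exists d => // _ /SE[b ->] /dP; rewrite !hk => ab; rewrite !cE ab.
- move=> _ _ /SE[a ->] /SE[b ->]; rewrite !cE !modn_small// => ab.
  by apply: JP; exact: val_inj.
Qed.

End OdometerPartition.

(** * Closures of regularly recurrent orbits *)

Section OrbitClosure.
Context {R : realType} {X : metricType R}.
Implicit Types (f : X -> X) (x y z w : X) (S : set X) (e : R).

Lemma eq_of_mdist_le_natSinv x y :
  (forall j, mdist x y <= (j.+1%:R^-1 : R)) -> x = y.
Proof.
move=> xy; apply: contrapT => /eqP; rewrite -(@mdist_gt0 R) => xy0.
have [n _ /(_ n (leqnn n))] := near_infty_natSinv_lt (PosNum xy0).
by rewrite /= ltNge xy.
Qed.

(** A finite orbit is closed, so density makes it all of [S]. *)
Lemma dense_periodic_orbit f y S p : closed S -> invariant_set f S ->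
  (forall n, S (iter n f y)) ->
  (forall z, S z -> forall e, 0 < e -> exists n, mdist z (iter n f y) < e) ->
  (0 < p)%N -> iter p f y = y -> is_periodic_orbit f S.
Proof.
move=> cS fS Sy Sdense p0 py; split => //; exists y, p; split => //.
  exact: (Sy 0%N).
have iter_mul q : iter (q * p) f y = y.
  by elim: q => // q IHq; rewrite mulSn addnC iterD py.
have cl : closed [set iter k f y | k in `I_p].
  apply: (accessible_finite_set_closed.1 (hausdorff_accessible (@metric_hausdorff _ X))).
  exact: finite_image.
rewrite eqEsubset; split=> [z Sz|_ [k _ <-]//].
apply: cl => V /near_mdistP[d d0 dV]; have [n zn] := Sdense z Sz d d0.
exists (iter n f y); split; last exact: dV.
exists (n %% p)%N; first exact: ltn_pmod.
by rewrite [in RHS](divn_eq n p) addnC iterD iter_mul.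
Qed.

Lemma exists_period_structure f y : regularly_recurrent f y ->
  (forall p, (0 < p)%N -> iter p f y <> y) ->
  exists m, [/\ periodic_structure m,
    forall j, separating_period f y (m j) &
    forall j n, almost_period f y (j.+1%:R^-1) (m j * n)].
Proof.
move=> yrec nper.
pose next j m := [set m' | [/\ (0 < m')%N, (m %| m')%N, separating_period f y m' &
  forall n, almost_period f y (j.+1%:R^-1) (m' * n)]].
have nextP j m : (0 < m)%N -> separating_period f y m ->
    next j m (xget 1%N (next j m)).
  move=> m0 msep; apply: xgetPex.
  have j0 : 0 < (j.+1%:R^-1 : R) by rewrite invr_gt0 ltr0Sn.
  exact: separating_period_refine yrec m0 msep j0.
(* The recursion refines the trivial separating period 1; [nextP] ensures that the default of [xget]
   is never taken. *)
pose m := fix m j := xget 1%N (next j (if j is k.+1 then m k else 1%N)).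
have mP j : next j (if j is k.+1 then m k else 1%N) (m j).
  elim: j => [|j [mj0 _ mjsep _]]; last exact: nextP.
  by apply: nextP => //; exists 1 => // n _; exact: dvd1n.
have m0 j : (0 < m j)%N by have [] := mP j.
have mdvd j : (m j %| m j.+1)%N by have [] := mP j.+1.
have mle : {homo m : i j / (i <= j)%N}.
  apply: homo_leq => [//|? ? ?|j]; first exact: leq_trans.
  exact: dvdn_leq.
have map_ j n : almost_period f y (j.+1%:R^-1) (m j * n) by have [] := mP j.
exists m; split => //; last by move=> j; have [] := mP j.
split => //; apply/cvgnyPge => B; apply: contrapT => nB.
have mB j : (m j <= B)%N.
  rewrite leqNgt; apply/negP => Bj; apply: nB; exists j => // i ji.
  exact: leq_trans (ltnW Bj) (mle _ _ ji).
(* If all [m j] were at most [B], they would all divide the factorial of [B], which would be an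
   exact period of [y]. *)
apply: (nper B`!); first exact: fact_gt0.
apply: eq_of_mdist_le_natSinv => j.
have /dvdnP[q ->] : (m j %| B`!)%N by apply: dvdn_fact; rewrite m0 mB.
by have := map_ j q 0%N; rewrite addn0 mulnC.
Qed.

Lemma dense_odometer f y S : compact [set: X] -> continuous f ->
  closed S -> invariant_set f S -> (forall n, S (iter n f y)) ->
  (forall z, S z -> forall e, 0 < e -> exists n, mdist z (iter n f y) < e) ->
  regularly_recurrent f y -> (forall p, (0 < p)%N -> iter p f y <> y) ->
  is_odometer f S.
Proof.
move=> cptX cf cS fS Sy Sdense yrec nper.
have [m [hm msep mper]] := exists_period_structure yrec nper.
have m0 j : (0 < m j)%N by case: (hm).
have code (z : S) j : exists r : 'I_(m j), exists2 d : R, 0 < d &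
    forall a, mdist (val z) (iter a f y) < d -> a = r %[mod m j].
  have [d d0 dP] := near_orbit_eqmod (val z) cf yrec (m0 j) (msep j).
  have [b zb] := Sdense _ (set_valP z) d d0.
  exists (Ordinal (ltn_pmod b (m0 j))), d => // a za /=.
  by rewrite modn_mod; exact: dP.
pose dig (z : S) j : 'I_(m j) := projT1 (cid (code z j)).
have digP (z : S) j : exists2 d : R, 0 < d &
    forall a, mdist (val z) (iter a f y) < d -> a = dig z j %[mod m j].
  exact: projT2 (cid (code z j)).
have near2 (z : S) d d' : 0 < d -> 0 < d' -> exists a,
    mdist (val z) (iter a f y) < d /\ mdist (val z) (iter a f y) < d'.
  move=> d0 d'0; have [|a] := Sdense _ (set_valP z) (Num.min d d').
    by rewrite lt_min d0.
  by rewrite lt_min => /andP[]; exists a.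
(* Orbit times near [z] share one residue, so a residue found arbitrarily near [z] is the digit. *)
have digE (z : S) j (r : 'I_(m j)) : (forall d : R, 0 < d -> exists2 a,
    mdist (val z) (iter a f y) < d & a = r %[mod m j]) -> dig z j = r.
  move=> H; have [d d0 dP] := digP z j; have [a /dP -> ar] := H d d0.
  by apply: val_inj; move: ar; rewrite !modn_small.
have digS (z : S) : odometer_space m (dig z).
  move=> j; have [d d0 dP] := digP z j; have [d' d'0 dP'] := digP z j.+1.
  have [a [/dP <- /dP' ar]] := near2 z d d' d0 d'0.
  have [_ _ /(_ j) mj _] := hm.
  by rewrite -(modn_dvdm _ mj) ar modn_dvdm.
pose k (z : S) : odometer_space m := exist _ (dig z : digits m) (mem_set (digS z)).
have k_cont : continuous k.
  move=> z; apply: (@odometer_cvg m S (nbhs z)) => j; apply/near_set_val.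
  have [d d0 dP] := digP z j; exists (d / 2); first lra.
  move=> w zw; apply: digE => d' d'0; have d20 : 0 < d / 2 by lra.
  have [a [wa wa']] := near2 w d' (d / 2) d'0 d20; exists a => //.
  by apply: dP; have := metric_triangle (val z) (val w) (iter a f y); lra.
have k_equi (z : S) : k (restr fS z) = odometer_map hm (k z).
  apply: val_inj; apply: functional_extensionality_dep => j; apply: digE => d d0.
  have [d1 d10 dP1] := continuous_mdist (val z) cf d0.
  have [d2 d20 dP2] := digP z j.
  have [a [/dP1 fza /dP2 ar]] := near2 z d1 d2 d10 d20; exists a.+1 => //=.
  by rewrite modn_mod -addn1 -modnDml ar modnDml addn1.
(* This estimate yields both injectivity of [k] and continuity of its inverse. *)
have k_mdist (z w : S) j : val (k z) j = val (k w) j ->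
    mdist (val z) (val w) <= (j.+1%:R^-1 : R).
  move=> zw; apply/ler_addgt0Pr => e e0; have e20 : 0 < e / 2 by lra.
  have [d d0 dP] := digP z j; have [d' d'0 dP'] := digP w j.
  have [a [za /dP ar]] := near2 z (e / 2) d e20 d0.
  have [b [wb /dP' br]] := near2 w (e / 2) d' e20 d'0.
  have ab : a = b %[mod m j] by rewrite ar br; congr (nat_of_ord _ %% _)%N.
  have := almost_period_modn (mper j) ab; move: (j.+1%:R^-1) => c abc.
  have := mdist_path3 (val z) (iter a f y) (iter b f y) (val w).
  rewrite (metric_sym (iter b f y) (val w)); lra.
have k_inj : injective k.
  move=> z w zw; apply: val_inj; apply: eq_of_mdist_le_natSinv => j.
  by apply: k_mdist; rewrite zw.
(* A preimage is a cluster point of the orbit at the times given by the digits of [a]; from index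
   [j] on these are congruent mod [m j]. *)
have k_surj a : exists z : S, k z = a.
  have [z zP] := compact_seq_cluster (fun j => iter (val a j) f y) cptX.
  have Sz : S z.
    apply: cS => V /near_mdistP[d d0 dV]; have [i _ zi] := zP d d0 0%N.
    by exists (iter (val a i) f y); split; [exact: Sy|exact: dV].
  exists (exist _ z (mem_set Sz)); apply: val_inj.
  apply: functional_extensionality_dep => j; apply: digE => d d0.
  have [i ji zi] := zP d d0 j; exists (val a i) => //.
  by symmetry; exact: odometer_digit.
have [h hk] := choice k_surj.
split => //; exists fS, m, hm, h; split.
  exists k; split => //; first by move=> z; apply: k_inj; rewrite hk.
  move=> a V /near_set_val[d d0 dV].
  have [j _ /(_ j (leqnn j)) /= jd] := near_infty_natSinv_lt (PosNum d0).
  apply: filterS (near_odometer_digit a j) => b ba; apply: dV.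
  by apply: le_lt_trans (k_mdist _ _ j _) jd; rewrite !hk.
by apply/funext => a /=; apply: k_inj; rewrite k_equi !hk.
Qed.

(** * The characterization by eventual almost periodicity and the conclusion *)

Lemma eap_asymptotic f x : compact [set: X] -> continuous f ->
  eventually_almost_periodic f x -> asymptotic_to_periodic_or_odometer f x.
Proof.
move=> cptX cf xap; have [y xy] := omega_limit_neq0 f x cptX.
have Sy n : omega_limit f x (iter n f y) by exact: omega_limit_iter.
have Sdense z (xz : omega_limit f x z) := eap_orbit_dense cf xap xy xz.
have cS := @closed_omega_limit _ _ f x.
have fS := @omega_limit_invariant _ _ f x cf.
have [[p p0 py]|nper] := pselect (exists2 p, (0 < p)%N & iter p f y = y).
  by left; exact: dense_periodic_orbit p0 py.
right; apply: (@dense_odometer f y) => //.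
  exact: eap_regularly_recurrent xap xy.
by move=> p p0 py; apply: nper; exists p.
Qed.

Lemma asymptotic_eap f x : compact [set: X] -> continuous f ->
  asymptotic_to_periodic_or_odometer f x -> eventually_almost_periodic f x.
Proof.
move=> cptX cf xA; apply: cyclic_partition_eap => // e e0.
by case: xA => [/(periodic_orbit_partition e0)|/(odometer_partition cptX e0)].
Qed.

End OrbitClosure.

Theorem theorem1p1 (R : realType) (X : metricType R) (f : X -> X) (x : X)
  (cptX : compact [set: X]) (cf : continuous f)
  (hx : forall eps : R, 0 < eps ->
    exists xe : X, asymptotic_to_periodic_or_odometer f xe /\
      (limn_esup (fun i : nat => (mdist (iter i f x) (iter i f xe))%:E)
         <= eps%:E)%E) :
  asymptotic_to_periodic_or_odometer f x.
Proof.
apply: eap_asymptotic => //; apply: eap_limit => eps /hx[xe [xeA xxe]].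
by exists xe; split => //; exact: asymptotic_eap.
Qed.
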